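(* Let $s\ge 1$ and $n\ge 4s$ be integers, and let $T^{n,n-s}$ be the labeled $(n-s)$-grid obtained from the all-ones $n$-grid by $s$ reductions. For each integer $d$ with $1\le d\le s$ consider the three sets of triangles $$U_1(d)=\{T^{n,n-s}_{r,d} : s+d\le r\le n-2s\},$$ $$U_2(d)=\{T^{n,n-s}_{r,r+1-d} : s+d\le r\le n-2s\},$$ $$U_3(d)=\{T^{n,n-s}_{n-s-d+1,\,p} : s+d\le p\le n-2s\},$$ whose union is called the uniform center. Then: (a) For each $d$ with $1\le d\le s$ and each $i\in\{1,2,3\}$, all triangles in $U_i(d)$ have a single pre-type. (b) For each $d$ with $1\le d\le s$, all triangles in $U_1(d)\cup U_2(d)\cup U_3(d)$ are of the same type. (c) In the $s$-subgrid $T^{n,n-s,s}$ all interior edge labels are equal to $1$, and all edge labels on the edge boundary $\partial^2T^{n,n-s,s}$ are equal to each other. (d) For every $d$ with $1\le d\le s$: every triangle in $U_1(d)$ has equal right and base labels; every triangle in $U_2(d)$ has equal left and base labels; every triangle in $U_3(d)$ has equal left and right labels.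
   Context: Labeled grids. An $N$-grid is the triangular grid graph with $N$ rows of upright triangles. The upright triangles are $T_{r,d}$ with $1\le d\le r\le N$ ($r$ is the row, counted from the top; $d$ is the diagonal, counted from the left). Each edge of the grid is a side of exactly one upright triangle, and the left, right and base sides of $T_{r,d}$ are denoted $T_{r,d,L},T_{r,d,R},T_{r,d,B}$. The bottom-right vertex of $T_{r,d}$, the bottom-left vertex of $T_{r,d+1}$ and the top vertex of $T_{r+1,d+1}$ coincide (whenever these exist). A labeled $N$-grid assigns a positive real number (resistance) to each edge; the symbol $T_{r,d,X}$, $X\in\{L,R,B\}$, also denotes this label. Reduction. For positive reals put $\Delta(x,y,z)=\frac{xy}{x+y+z}$ and $Y(x,y,z)=\frac{xy+yz+zx}{x}$. The reduction of a labeled $N$-grid ($N\ge2$) is a labeled $(N-1)$-grid obtained by applying $\Delta$–Y transformations to all upright triangles, discarding the three corner tails, making series transformations along the boundary and Y–$\Delta$ transformations in the interior. Explicitly, if $T_{r,d}$ has labels $(l,\rho,b)$ on its (left, right, base) sides, set $Y_{12,r,d}=\Delta(l,\rho,b)$, $Y_{8,r,d}=\Delta(b,l,\rho)$, $Y_{4,r,d}=\Delta(\rho,b,l)$. The reduced grid has, for $1\le d\le r\le N-1$, labels left: $Y_{8,r,1}+Y_{12,r+1,1}$ if $d=1$, and $Y(Y_{4,r,d-1},Y_{8,r,d},Y_{12,r+1,d})$ if $d\ge2$; right: $Y_{4,r,r}+Y_{12,r+1,r+1}$ if $d=r$, and $Y(Y_{8,r,d+1},Y_{12,r+1,d+1},Y_{4,r,d})$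 if $d\le r-1$; base: $Y_{4,N,d}+Y_{8,N,d+1}$ if $r=N-1$, and $Y(Y_{12,r+2,d+1},Y_{4,r+1,d},Y_{8,r+1,d+1})$ if $r\le N-2$. $T^{n}=T^{n,n}$ is the $n$-grid with all labels equal to $1$, and $T^{n,m}$ (for $1\le m\le n$) is the labeled $m$-grid obtained from it by $n-m$ successive reductions. $T^{n,m}_{r,d}$ is its triangle in row $r$ and diagonal $d$. Pre-type and type. The pre-type of $T_{r,d}$ is the ordered triple of labels (left, right, base). Two triangles have the same type if their pre-types agree up to a permutation of the three entries (i.e. up to a symmetry of the triangle). Subgrids. For $s\ge1$ the $s$-subgrid $T^{n,m,s}$ of $T^{n,m}$ is the triangular subgrid with corner triangles $T_{2s-1,s}$, $T_{m+1-s,s}$, $T_{m+1-s,m+2-2s}$, i.e. it consists of the triangles $T_{r,d}$ with $2s-1\le r\le m+1-s$, $s\le d\le r-s+1$. Its edge boundary $\partial^2T^{n,m,s}$ consists of the edges $T_{r,s,L}$ and $T_{r,r-s+1,R}$ for $2s-1\le r\le m+1-s$, and $T_{m+1-s,d,B}$ for $s\le d\le m+2-2s$. Its interior consists of all edges of triangles of $T^{n,m,s}$ not in $\partial^2T^{n,m,s}$.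
   Formalization: U_3(d) is taken as {T_{n-s-d+1, p+1-d} : s+d ≤ p ≤ n-2s}, the rotation image of U_1(d), instead of diagonal p; with diagonal p the claim is false (n=8, s=d=2: T_{5,4} has left label 1 and right label 26/27). *)

(* Defs.v *)
From mathcomp Require Import all_boot all_order all_algebra.

Set Implicit Arguments.
Unset Strict Implicit.
Unset Printing Implicit Defensive.

Import Order.TTheory GRing.Theory Num.Theory.
Local Open Scope ring_scope.

(* Indices are 1-based: (r, d) is the upright triangle in row r (from the
   top) and diagonal d (from the left); it lies in the N-grid iff
   1 <= d <= r <= N.  Since each edge is a side of exactly one upright
   triangle, an edge is a pair (triangle, side). *)
Definition triangle := (nat * nat)%type.

Inductive side := SideL | SideR | SideB.

(* The size N is not part of the type; values at triangles outside the N-grid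
   are irrelevant. *)
Definition labeling (R : Type) := triangle -> side -> R.

Definition in_grid (N : nat) (t : triangle) : bool :=
  (1 <= t.2)%N && (t.2 <= t.1 <= N)%N.

Definition labeled_grid (R : realFieldType) (N : nat) (T : labeling R) : Prop :=
  forall t X, in_grid N t -> 0 < T t X.

Definition Delta (R : realFieldType) (x y z : R) : R := x * y / (x + y + z).

Definition Yfun (R : realFieldType) (x y z : R) : R :=
  (x * y + y * z + z * x) / x.

(* The leg of the star replacing (r, d) that ends at the top (Y12), the
   bottom-left (Y8), or the bottom-right (Y4) vertex of the triangle. *)
Definition Y12 (R : realFieldType) (T : labeling R) (r d : nat) : R :=
  Delta (T (r, d) SideL) (T (r, d) SideR) (T (r, d) SideB).
Definition Y8 (R : realFieldType) (T : labeling R) (r d : nat) : R :=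
  Delta (T (r, d) SideB) (T (r, d) SideL) (T (r, d) SideR).
Definition Y4 (R : realFieldType) (T : labeling R) (r d : nat) : R :=
  Delta (T (r, d) SideR) (T (r, d) SideB) (T (r, d) SideL).

(* T is read as an N-grid, and the result is to be read as an (N-1)-grid. *)
Definition reduction (R : realFieldType) (T : labeling R) (N : nat)
    : labeling R := fun t X =>
  let: (r, d) := t in
  match X with
  | SideL =>
      if d == 1%N then Y8 T r 1 + Y12 T r.+1 1
      else Yfun (Y4 T r d.-1) (Y8 T r d) (Y12 T r.+1 d)
  | SideR =>
      if d == r then Y4 T r r + Y12 T r.+1 r.+1
      else Yfun (Y8 T r d.+1) (Y12 T r.+1 d.+1) (Y4 T r d)
  | SideB =>
      if r == N.-1 then Y4 T N d + Y8 T N d.+1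
      else Yfun (Y12 T r.+2 d.+1) (Y4 T r.+1 d) (Y8 T r.+1 d.+1)
  end.

Fixpoint reductions (R : realFieldType) (k N : nat) (T : labeling R)
    : labeling R :=
  if k is k'.+1 then reductions k' N.-1 (reduction T N) else T.

(* The grid T^{n,m}. *)
Definition gridT (R : realFieldType) (n m : nat) : labeling R :=
  reductions (n - m) n (fun _ _ => 1).

Definition pretype (R : realFieldType) (T : labeling R) (t : triangle)
    : 3.-tuple R :=
  [tuple T t SideL; T t SideR; T t SideB].

Definition same_type (R : realFieldType) (T : labeling R) (t t' : triangle)
    : bool :=
  perm_eq (pretype T t) (pretype T t').

Definition single_pretype (R : realFieldType) (T : labeling R)
    (U : triangle -> Prop) : Prop :=
  forall t t', U t -> U t' -> pretype T t = pretype T t'.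

Definition U1 (n s d : nat) (t : triangle) : Prop :=
  exists2 r, (s + d <= r <= n - 2 * s)%N & t = (r, d).

Definition U2 (n s d : nat) (t : triangle) : Prop :=
  exists2 r, (s + d <= r <= n - 2 * s)%N & t = (r, r + 1 - d)%N.

(* U1, U2, U3 are exchanged by the rotations of the (n-s)-grid.  On row
   n-s-d+1 the image of U1 occupies the diagonals s+1, ..., n-2s-d+1, hence
   the shift p + 1 - d.  Using diagonal p instead would give another set for
   d > 1, which in general contains triangles of a different type: for n = 8
   and s = d = 2 it would be {(5, 4)}, with labels (1, 26/27, 26/27), while
   U1 = {(4, 2)} has labels (26/27, 1, 1). *)
Definition U3 (n s d : nat) (t : triangle) : Prop :=
  exists2 p, (s + d <= p <= n - 2 * s)%N
           & t = (n - s - d + 1, p + 1 - d)%N.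

(* The triangles of the s-subgrid of an m-grid. *)
Definition subgrid (m s : nat) (t : triangle) : bool :=
  (2 * s - 1 <= t.1 <= m + 1 - s)%N && (s <= t.2 <= t.1 - s + 1)%N.

Definition edge_boundary (m s : nat) (t : triangle) (X : side) : bool :=
  let: (r, d) := t in
  match X with
  | SideL => (d == s) && (2 * s - 1 <= r <= m + 1 - s)%N
  | SideR => (d == r - s + 1)%N && (2 * s - 1 <= r <= m + 1 - s)%N
  | SideB => (r == m + 1 - s)%N && (s <= d <= m + 2 - 2 * s)%N
  end.

Definition subgrid_interior (m s : nat) (t : triangle) (X : side) : bool :=
  subgrid m s t && ~~ edge_boundary m s t X.

(* Reduction preserves positivity, so no division by zero occurs within the
   grids. *)

Lemma Delta_gt0 (R : realFieldType) (x y z : R) :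
  0 < x -> 0 < y -> 0 < z -> 0 < Delta x y z.
Proof. by move=> *; rewrite divr_gt0 ?mulr_gt0 ?addr_gt0. Qed.

Lemma Yfun_gt0 (R : realFieldType) (x y z : R) :
  0 < x -> 0 < y -> 0 < z -> 0 < Yfun x y z.
Proof. by move=> *; rewrite divr_gt0 ?addr_gt0 ?mulr_gt0. Qed.

Lemma reduction_labeled_grid (R : realFieldType) (N : nat) (T : labeling R) :
  labeled_grid N T -> labeled_grid N.-1 (reduction T N).
Proof.
move=> T_gt0 [r d] X /andP[/= d_gt0 /andP[le_dr]].
case: N T_gt0 => [|N] T_gt0 /= le_rN.
  by move: (leq_trans d_gt0 (leq_trans le_dr le_rN)).
have Y_gt0 r' d' : (0 < d')%N -> (d' <= r')%N -> (r' <= N.+1)%N ->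
    [/\ 0 < Y12 T r' d', 0 < Y8 T r' d' & 0 < Y4 T r' d'].
  move=> d'0 ler leN.
  have t_in : in_grid N.+1 (r', d') by rewrite /in_grid /= d'0 ler leN.
  by split; apply: Delta_gt0; apply: T_gt0.
have r_gt0 : (0 < r)%N by apply: leq_trans le_dr.
have [a1 a2 a3] := Y_gt0 r d d_gt0 le_dr (leqW le_rN).
have [b1 b2 b3] := Y_gt0 r.+1 d d_gt0 (leqW le_dr) le_rN.
have [c1 c2 c3] := Y_gt0 r.+1 d.+1 isT le_dr le_rN.
case: X => /=.
- case: eqP => [d1|d1].
    by rewrite -{1}d1 -{1}d1 addr_gt0.
  have d_gt1 : (1 < d)%N by rewrite ltn_neqAle eq_sym d_gt0 andbT; apply/eqP.
  have [e1 e2 e3] : [/\ 0 < Y12 T r d.-1, 0 < Y8 T r d.-1 & 0 < Y4 T r d.-1].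
    apply: Y_gt0; [by rewrite -ltnS prednK | exact: leq_trans (leq_pred _) _ |].
    exact: leqW.
  exact: Yfun_gt0.
- case: eqP => [dr|dr].
    by rewrite -{1}dr -dr in a3 c1 *; rewrite addr_gt0.
  have lt_dr : (d < r)%N by rewrite ltn_neqAle le_dr andbT; apply/eqP.
  have [e1 e2 e3] := Y_gt0 r d.+1 isT lt_dr (leqW le_rN).
  exact: Yfun_gt0.
- case: eqP => [rN|rN].
    by rewrite -rN addr_gt0.
  have lt_rN : (r < N)%N by rewrite ltn_neqAle le_rN andbT; apply/eqP.
  have [e1 e2 e3] := Y_gt0 r.+2 d.+1 isT (leqW le_dr) lt_rN.
  exact: Yfun_gt0.
Qed.

Lemma gridT_labeled_grid (R : realFieldType) (n m : nat) :
  (m <= n)%N -> labeled_grid m (gridT R n m).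
Proof.
move=> le_mn.
have H k N (T : labeling R) :
    labeled_grid N T -> labeled_grid (N - k) (reductions k N T).
  elim: k N T => [|k IHk] N T T_gt0; first by rewrite subn0.
  rewrite subnS -subn1 subnAC subn1.
  by apply/IHk/reduction_labeled_grid.
rewrite -{1}(subKn le_mn); apply: H => t X _; exact: ltr01.
Qed.

(* Main.v *)
Require Import Defs.
From mathcomp Require Import all_boot all_order all_algebra.
From mathcomp Require Import zify ring.

(** Near the left side of the grid, and away from the two other sides, the
    labels depend only on the distance to the left side, and the right and base
    labels agree: a reduction preserves both properties, and each reduction
    costs one more row of triangles at the two other sides.  For the left
    labels the loss is delayed by one reduction, since the new left label is
    computed from triangles that are at least as far from the other sides; this
    is what makes the corners of the subgrid work.  Labels different from 1
    penetrate one row further from the left side at each reduction.  The two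
    other sides are handled by the rotational symmetry of the reduction. *)

Set Implicit Arguments.
Unset Strict Implicit.
Unset Printing Implicit Defensive.

Import GRing.Theory.
Local Open Scope ring_scope.

(* The triangle with i, j and k triangles between it and the left, right and
   base sides of the N-grid, where N = i + j + k + 1. *)
Definition tri (i j : nat) : triangle := ((i + j).+1, i.+1)%N.

Lemma triE (N r d : nat) : in_grid N (r, d) -> (r, d) = tri d.-1 (r - d).
Proof. by rewrite /in_grid /tri /=; move=> h; congr pair; lia. Qed.

(** [reductions] unfolds at the first step, whereas the inductions below append one more reduction
    at the end. *)
Lemma reductionsSr (R : realFieldType) (k N : nat) (T : labeling R) :
  reductions k.+1 N T = reduction (reductions k N T) (N - k).
Proof.
elim: k N T => [|k IHk] N T; first by rewrite subn0.
rewrite -[LHS]/(reductions k.+1 N.-1 (reduction T N)) IHk.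
by congr reduction; lia.
Qed.

Section Reduction.
Variables (R : realFieldType) (T : labeling R).

Lemma reduction_L0 (N j : nat) :
  reduction T N (tri 0 j) SideL = Y8 T j.+1 1 + Y12 T j.+2 1.
Proof. by []. Qed.

(** The index pairs keep the shape of [tri], so that facts stated by distances rewrite them. Here,
    in [reduction_R] and in [reduction_B], the three triangles meet at an interior vertex. *)
Lemma reduction_L (N i j : nat) :
  reduction T N (tri i.+1 j) SideL =
  Yfun (Y4 T (i + j.+1).+1 i.+1) (Y8 T (i.+1 + j).+1 i.+2)
    (Y12 T (i.+1 + j.+1).+1 i.+2).
Proof. by rewrite /= addnS !addSn addnS. Qed.

Lemma reduction_R0 (N i : nat) :
  reduction T N (tri i 0) SideR = Y4 T i.+1 i.+1 + Y12 T i.+2 i.+2.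
Proof. by rewrite /= addn0 eqxx. Qed.

Lemma reduction_R (N i j : nat) :
  reduction T N (tri i j.+1) SideR =
  Yfun (Y8 T (i.+1 + j).+1 i.+2) (Y12 T (i.+1 + j.+1).+1 i.+2)
    (Y4 T (i + j.+1).+1 i.+1).
Proof. by rewrite /= ifN ?addSn -?addnS //; lia. Qed.

Lemma reduction_B0 (i j : nat) :
  reduction T (i + j).+2 (tri i j) SideB =
  Y4 T (i + j.+1).+1 i.+1 + Y8 T (i.+1 + j).+1 i.+2.
Proof. by rewrite /= eqxx addnS. Qed.

Lemma reduction_B (i j k : nat) :
  reduction T (i + j + k.+1).+2 (tri i j) SideB =
  Yfun (Y12 T (i.+1 + j.+1).+1 i.+2) (Y4 T (i + j.+1).+1 i.+1)
    (Y8 T (i.+1 + j).+1 i.+2).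
Proof. by rewrite /= ifN ?addSn ?addnS //; lia. Qed.

End Reduction.

(** A third of a turn permutes the distances [(i, j, k)] cyclically, and the three sides of each
    triangle along with them. *)
Definition rotation_invariant {R : realFieldType} (N : nat) (T : labeling R) :=
  forall i j k, (i + j + k).+1 = N ->
  [/\ T (tri j k) SideL = T (tri i j) SideR,
      T (tri j k) SideR = T (tri i j) SideB
    & T (tri j k) SideB = T (tri i j) SideL].

Lemma rotation_invariant_Y (R : realFieldType) (N : nat) (T : labeling R) :
  rotation_invariant N T ->
  forall i j k, (i + j + k).+1 = N ->
  [/\ Y12 T (j + k).+1 j.+1 = Y4 T (i + j).+1 i.+1,
      Y8 T (j + k).+1 j.+1 = Y12 T (i + j).+1 i.+1
    & Y4 T (j + k).+1 j.+1 = Y8 T (i + j).+1 i.+1].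
Proof.
move=> symT i j k eN; have [eL eR eB] := symT i j k eN.
by rewrite /Y12 /Y8 /Y4 -!/(tri _ _) eL eR eB.
Qed.

(** The rotation carries the three legs at a vertex to the three legs at its image, in the order in
    which [Yfun] takes them. A vanishing distance puts the edge on the boundary, where the series
    formulas are matched instead. *)
Lemma reduction_rotation_invariant (R : realFieldType) (N : nat)
    (T : labeling R) :
  rotation_invariant N.+1 T -> rotation_invariant N (reduction T N.+1).
Proof.
move=> /rotation_invariant_Y symY.
have E12 i j k : (i + j + k = N)%N ->
  Y12 T (j + k).+1 j.+1 = Y4 T (i + j).+1 i.+1.
  by move=> e; case: (symY i j k) => [|->]; rewrite ?e.
have E8 i j k : (i + j + k = N)%N ->
  Y8 T (j + k).+1 j.+1 = Y12 T (i + j).+1 i.+1.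
  by move=> e; case: (symY i j k) => [|_ ->]; rewrite ?e.
have E4 i j k : (i + j + k = N)%N ->
  Y4 T (j + k).+1 j.+1 = Y8 T (i + j).+1 i.+1.
  by move=> e; case: (symY i j k) => [|_ _ ->]; rewrite ?e.
move=> i j k eN; split.
- case: j eN => [|j] eN.
    rewrite reduction_L0 reduction_R0 addrC; congr +%R.
      by rewrite (E12 i 0%N k.+1) ?addn0 //; lia.
    by rewrite (E8 i.+1 0%N k) ?addn0 //; lia.
  by rewrite reduction_L reduction_R (E4 i.+1 j k.+1)
    ?(E8 i.+1 j.+1 k) ?(E12 i j.+1 k.+1) //; lia.
- case: k eN => [|k] eN.
    have -> : N.+1 = (i + j).+2 by lia.
    rewrite reduction_R0 reduction_B0 addrC; congr +%R.
      by have := E12 i j.+1 0%N; rewrite !addn0 => -> //; lia.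
    by have := E4 i.+1 j 0%N; rewrite !addn0 => -> //; lia.
  have -> : N.+1 = (i + j + k.+1).+2 by lia.
  rewrite reduction_R reduction_B (E8 i.+1 j.+1 k)
    ?(E12 i j.+1 k.+1) ?(E4 i.+1 j k.+1) //; lia.
- case: i eN => [|i] eN.
    have -> : N.+1 = (j + k).+2 by lia.
    rewrite reduction_B0 reduction_L0.
    by rewrite (E4 0%N j k.+1) ?(E8 0%N j.+1 k) //; lia.
  have -> : N.+1 = (j + k + i.+1).+2 by lia.
  rewrite reduction_B reduction_L (E12 i j.+1 k.+1)
    ?(E4 i.+1 j k.+1) ?(E8 i.+1 j.+1 k) //; lia.
Qed.

Lemma reductions_rotation_invariant (R : realFieldType) (k N : nat)
    (T : labeling R) :
  (k <= N)%N -> rotation_invariant N T ->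
  rotation_invariant (N - k) (reductions k N T).
Proof.
move=> + symT; elim: k => [|k IHk] lekN; first by rewrite subn0.
rewrite reductionsSr; have -> : (N - k = (N - k.+1).+1)%N by lia.
apply: reduction_rotation_invariant.
have -> : ((N - k.+1).+1 = N - k)%N by lia.
exact: IHk (ltnW lekN).
Qed.

(** The bounds differ because a new right or base label reads a triangle one step nearer to the
    right or base side, while a new left label reads none nearer to either; it reads one nearer to
    the left side instead. *)
Lemma left_side_labels (R : realFieldType) (s n : nat) :
  (s <= n)%N ->
  exists x y : nat -> R,
    [/\ forall i, (s <= i)%N -> x i = 1,
        forall i, (s <= i.+1)%N -> y i = 1,
        forall i j k, (i + j + k).+1 = (n - s)%N ->
          (s <= j.+1)%N -> (s <= k.+1)%N ->
          reductions s n (fun _ _ => 1) (tri i j) SideL = x i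
      & forall i j k, (i + j + k).+1 = (n - s)%N ->
          (s <= j)%N -> (s <= k)%N ->
          reductions s n (fun _ _ => 1) (tri i j) SideR = y i /\
          reductions s n (fun _ _ => 1) (tri i j) SideB = y i].
Proof.
elim: s => [|s IHs] lesn; first by exists (fun=> 1), (fun=> 1).
have {IHs}[|x [y [x1 y1 Lx RBy]]] := IHs; first exact: ltnW.
(* [p i] is the leg at both ends of the left side, [q i] the leg at the opposite vertex. *)
pose p i := Delta (x i) (y i) (y i); pose q i := Delta (y i) (y i) (x i).
have p1 i : (s <= i)%N -> p i = 3%:R^-1.
  by move=> le; rewrite /p x1 ?y1 1?leqW // /Delta; field.
have q1 i : (s <= i)%N -> q i = 3%:R^-1.
  by move=> le; rewrite /q x1 ?y1 1?leqW // /Delta; field.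
have Y1 : Yfun 3%:R^-1 3%:R^-1 3%:R^-1 = 1 :> R by rewrite /Yfun; field.
rewrite reductionsSr; set T := reductions s n _ in Lx RBy *.
have Yp i j k : (i + j + k).+1 = (n - s)%N -> (s <= j)%N -> (s <= k)%N ->
    [/\ Y12 T (i + j).+1 i.+1 = p i, Y8 T (i + j).+1 i.+1 = p i
      & Y4 T (i + j).+1 i.+1 = q i].
  move=> e lej lek; have [eR eB] := RBy _ _ _ e lej lek.
  have eL := Lx _ _ _ e (leqW lej) (leqW lek).
  rewrite /Y12 /Y8 /Y4 -!/(tri _ _) eR eB eL; split=> //.
  by rewrite /p /Delta; congr (_ / _); ring.
have Y12p i j k : (i + j + k).+1 = (n - s)%N -> (s <= j)%N -> (s <= k)%N ->
    Y12 T (i + j).+1 i.+1 = p i by move=> e lej lek; case: (Yp i j k).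
have Y8p i j k : (i + j + k).+1 = (n - s)%N -> (s <= j)%N -> (s <= k)%N ->
    Y8 T (i + j).+1 i.+1 = p i by move=> e lej lek; case: (Yp i j k).
have Y4q i j k : (i + j + k).+1 = (n - s)%N -> (s <= j)%N -> (s <= k)%N ->
    Y4 T (i + j).+1 i.+1 = q i by move=> e lej lek; case: (Yp i j k).
(* Read off from [reduction_L0], [reduction_L] and [reduction_R]. *)
exists (fun i => if i is i'.+1 then Yfun (q i') (p i) (p i) else p 0 + p 0),
  (fun i => Yfun (p i.+1) (p i.+1) (q i)); split.
- by case=> [//|i] lt_si; rewrite q1 ?p1 // ltnW.
- by move=> i le_si; rewrite q1 ?p1 // ltnW.
- case=> [|i] j k eN lej lek.
    rewrite reduction_L0.
    by rewrite (Y8p 0%N j k.+1) ?(Y12p 0%N j.+1 k) //; lia.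
  rewrite reduction_L.
  by rewrite (Y4q i _ k.+1) ?(Y8p _ _ k.+1) ?(Y12p _ _ k) //; lia.
- move=> i [//|j] [//|k] eN lej lek; split.
    by rewrite reduction_R (Y8p _ _ k.+2)
      ?(Y12p _ _ k.+1) ?(Y4q _ _ k.+2) //; lia.
  have -> : (n - s = (i + j.+1 + k.+1).+2)%N by lia.
  rewrite reduction_B.
  rewrite (Y12p _ _ k) ?(Y4q _ _ k.+1) ?(Y8p _ _ k.+1); try lia.
  (* [Yfun] is symmetric in its last two arguments, so the new right and base labels still agree. *)
  by rewrite /Yfun; congr (_ / _); ring.
Qed.

(** One and two rotations carry the description near the left side to the other two sides, with the
    same [x] and [y]. *)
Lemma gridT_side_labels (R : realFieldType) (s n : nat) :
  (s <= n)%N -> let T := gridT R n (n - s) in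
  exists x y : nat -> R,
    [/\ forall i, (s <= i)%N -> x i = 1,
        forall i j k, (i + j + k).+1 = (n - s)%N ->
          [/\ (s <= j.+1)%N -> (s <= k.+1)%N -> T (tri i j) SideL = x i,
              (s <= k.+1)%N -> (s <= i.+1)%N -> T (tri i j) SideR = x j
            & (s <= i.+1)%N -> (s <= j.+1)%N -> T (tri i j) SideB = x k]
      & forall i j k, (i + j + k).+1 = (n - s)%N ->
          [/\ (s <= j)%N -> (s <= k)%N ->
                pretype T (tri i j) = [tuple x i; y i; y i],
              (s <= k)%N -> (s <= i)%N ->
                pretype T (tri i j) = [tuple y j; x j; y j]
            & (s <= i)%N -> (s <= j)%N ->
                pretype T (tri i j) = [tuple y k; y k; x k]]].
Proof.
move=> lesn; rewrite /gridT subKn //.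
have [x [y [x1 _ Lx RBy]]] := left_side_labels R lesn.
have symT : rotation_invariant (n - s)
    (reductions s n (fun _ _ => 1) : labeling R).
  by apply: reductions_rotation_invariant.
move: (reductions _ _ _) => T in Lx RBy symT *.
have X i j k : (i + j + k).+1 = (n - s)%N ->
    [/\ (s <= j.+1)%N -> (s <= k.+1)%N -> T (tri i j) SideL = x i,
        (s <= k.+1)%N -> (s <= i.+1)%N -> T (tri i j) SideR = x j
      & (s <= i.+1)%N -> (s <= j.+1)%N -> T (tri i j) SideB = x k].
  move=> e; split=> *; first by apply: Lx e _ _.
    by have [<- _ _] := symT i j k e; apply: (@Lx j k i) => //; lia.
  have [_ <- _] := symT i j k e.
  by have [|<- _ _] := symT j k i; [lia | apply: (@Lx k i j) => //; lia].
exists x, y; split=> // i j k e; have [eL eR eB] := X i j k e.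
have [f1 f2 f3] := symT i j k e.
have [|g1 g2 g3] := symT j k i; first by lia.
split=> h h'; rewrite /pretype.
- by have [-> ->] := RBy i j k e h h'; rewrite eL ?leqW.
- have [|r b] := RBy j k i _ h h'; first by lia.
  by rewrite -f3 -f2 r b eR ?leqW.
- have [|r b] := RBy k i j _ h h'; first by lia.
  by rewrite -f3 -f1 -g2 -g3 r b eB ?leqW.
Qed.

Theorem theorem6p5 (R : realFieldType) (s n : nat)
    (hs : (1 <= s)%N) (hn : (4 * s <= n)%N) :
  let T := gridT R n (n - s) in
  [/\ (* (a) *)
      forall d, (1 <= d <= s)%N ->
        [/\ single_pretype T (U1 n s d),
            single_pretype T (U2 n s d)
          & single_pretype T (U3 n s d)],
      (* (b) *)
      forall d, (1 <= d <= s)%N ->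
        forall t t',
          U1 n s d t \/ U2 n s d t \/ U3 n s d t ->
          U1 n s d t' \/ U2 n s d t' \/ U3 n s d t' ->
          same_type T t t',
      (* (c) *)
      (forall t X, subgrid_interior (n - s) s t X -> T t X = 1) /\
      (forall t X t' X',
          edge_boundary (n - s) s t X -> edge_boundary (n - s) s t' X' ->
          T t X = T t' X')
    & (* (d) *)
      forall d, (1 <= d <= s)%N ->
        [/\ forall t, U1 n s d t -> T t SideR = T t SideB,
            forall t, U2 n s d t -> T t SideL = T t SideB
          & forall t, U3 n s d t -> T t SideL = T t SideR]].

Proof.
move=> T; have lesn : (s <= n)%N by lia.
have [x [y [x1 Tx Ty]]] := gridT_side_labels R lesn.
rewrite -/T in Tx Ty.
(* Each [U] set lies at distance [d.-1] from one side and at least [s] from the other two. *)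
have TU1 d t : (1 <= d <= s)%N -> U1 n s d t ->
    pretype T t = [tuple x d.-1; y d.-1; y d.-1].
  move=> hd [r hr ->]; rewrite (@triE (n - s));
    last by rewrite /in_grid /=; lia.
  by have [|-> //] := Ty d.-1 (r - d)%N (n - s - r)%N; lia.
have TU2 d t : (1 <= d <= s)%N -> U2 n s d t ->
    pretype T t = [tuple y d.-1; x d.-1; y d.-1].
  move=> hd [r hr ->]; rewrite (@triE (n - s));
    last by rewrite /in_grid /=; lia.
  have -> : (r - (r + 1 - d) = d.-1)%N by lia.
  by have [|_ -> //] := Ty (r + 1 - d).-1 d.-1 (n - s - r)%N; lia.
have TU3 d t : (1 <= d <= s)%N -> U3 n s d t ->
    pretype T t = [tuple y d.-1; y d.-1; x d.-1].
  move=> hd [p hp ->]; rewrite (@triE (n - s));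
    last by rewrite /in_grid /=; lia.
  by have [|_ _ -> //] := Ty (p + 1 - d).-1
    (n - s - d + 1 - (p + 1 - d))%N d.-1; lia.
split.
- move=> d hd; split=> t t' Ut Ut'.
  + by rewrite (TU1 d) ?(TU1 d t').
  + by rewrite (TU2 d) ?(TU2 d t').
  + by rewrite (TU3 d) ?(TU3 d t').
- move=> d hd.
  have type t : U1 n s d t \/ U2 n s d t \/ U3 n s d t ->
      perm_eq (pretype T t) [:: x d.-1; y d.-1; y d.-1].
    case=> [/(TU1 d t hd)->|[/(TU2 d t hd)->|/(TU3 d t hd)->]] //.
      by apply/permP => P /=; lia.
    by apply/permP => P /=; lia.
  move=> t t' /type Ut /type Ut'.
  by rewrite /same_type (permPl Ut) perm_sym.
- split.
  (* Subgrid triangles are at distance at least [s.-1] from every side, as [Tx] requires. An edge is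
     on the subgrid boundary when its distance to the parallel grid side is exactly [s.-1]; interior
     edges have distance at least [s], where [x] is 1. *)
  + move=> [r d] X /andP[]; rewrite /subgrid /= => ht hX.
    rewrite (@triE (n - s)); last by rewrite /in_grid /=; lia.
    have [|L1 R1 B1] := Tx d.-1 (r - d)%N (n - s - r)%N; first by lia.
    by case: X hX => hX; [rewrite L1 | rewrite R1 | rewrite B1];
      rewrite ?x1 //; lia.
  + have boundary t X : edge_boundary (n - s) s t X -> T t X = x s.-1.
      case: t X => [r d] X hX; rewrite (@triE (n - s)); last first.
        by case: X hX; rewrite /in_grid /=; lia.
      have [|L1 R1 B1] := Tx d.-1 (r - d)%N (n - s - r)%N.
        by case: X hX => /=; lia.
      by case: X hX => /= hX; [rewrite L1 | rewrite R1 | rewrite B1];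
        try (congr x); lia.
    by move=> t X t' X' /boundary-> /boundary->.
- move=> d hd; split=> t.
  + by move/(TU1 d t hd) => [_ -> ->].
  + by move/(TU2 d t hd) => [-> _ ->].
  + by move/(TU3 d t hd) => [-> -> _].
Qed.
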